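(* Let $p$ be a prime with $p>d$, let $B_0,\bar B_0$ be finite multisets of nonzero integers, let $f(s)=\frac{s}{e^s-1}$, and for $a\in\mathbb{Q}$ put $$F(s;a,B_0,\bar B_0)=e^{as}\prod_{b\in B_0} f(bs)\prod_{b\in\bar B_0} f(bs)^{-1}=\sum_{n\ge0} td_n\, s^n .$$ When $a=\frac{p_1(B_0)-p_1(\bar B_0)}{2}$, the sequence $(td_0,td_1,\dots,td_{d-1})$ modulo $p$ can be computed in time $$O\Big(d\log(d)+\log^2(d)\,\big(|B_0|+|\bar B_0|\big)\Big).$$
   Context: For a multiset $B$, $p_1(B)=\sum_{b\in B} b$ is the sum of its elements, and $|B|$ its cardinality, both with multiplicity. Time is measured in the number of ring operations in $\mathbb{Z}_p=\mathbb{Z}/p\mathbb{Z}$. The series $f(s)$ is expanded as a power series in $s$ with constant term $1$. It is assumed that the fast Fourier transform can be performed, so that two polynomials over $\mathbb{Z}_p$ of degree less than $n$ can be multiplied using $O(n\log n)$ operations in $\mathbb{Z}_p$. *)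

(* Defs.v *)
(* MathComp world. *)
From HB Require Import structures.
From mathcomp Require Import all_boot all_order all_algebra.

Set Implicit Arguments.
Unset Strict Implicit.
Unset Printing Implicit Defensive.

Import Order.TTheory GRing.Theory Num.Theory.
Local Open Scope ring_scope.

(* Formal power series, given by their coefficient sequences. *)

Definition fps (R : fieldType) := nat -> R.

Definition fps_one {R : fieldType} : fps R := fun n => (n == 0%N)%:R.

Definition fps_mul {R : fieldType} (u v : fps R) : fps R :=
  fun n => \sum_(i < n.+1) u i * v (n - i)%N.

(* The first n+1 coefficients of 1/u, obtained by solving u * v = 1 degree by
   degree; meaningful when u has a nonzero constant term. *)
Fixpoint fps_inv_seq {R : fieldType} (u : fps R) (n : nat) : seq R :=
  if n is m.+1 then
    let v := fps_inv_seq u m in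
    rcons v (- (u 0%N)^-1 * \sum_(i < m.+1) u i.+1 * v`_(m - i))
  else [:: (u 0%N)^-1].

Definition fps_inv {R : fieldType} (u : fps R) : fps R :=
  fun n => (fps_inv_seq u n)`_n.

(* u(s) |-> u(b s) *)
Definition fps_scale {R : fieldType} (b : R) (u : fps R) : fps R :=
  fun n => b ^+ n * u n.

(* e^(a s) *)
Definition fps_exp (a : rat) : fps rat := fun n => a ^+ n / (n`!)%:R.

(* f(s) = s / (e^s - 1), i.e. the inverse of (e^s - 1) / s;
   see todd_f_spec below. *)
Definition todd_f : fps rat := fps_inv (fun n => fps_exp 1 n.+1).

(* F(s; a, B, B'), the finite multisets B and B' being listed (in any order)
   by sequences. *)
Definition todd_F (a : rat) (B B' : seq int) : fps rat :=
  fps_mul (fps_exp a)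
    (fps_mul (\big[fps_mul/fps_one]_(b <- B) fps_scale b%:~R todd_f)
             (\big[fps_mul/fps_one]_(b <- B')
                fps_inv (fps_scale b%:~R todd_f))).

Definition td (a : rat) (B B' : seq int) (n : nat) : rat := todd_F a B B' n.

Definition p1 (B : seq int) : int := \sum_(b <- B) b.

Lemma size_fps_inv_seq (R : fieldType) (u : fps R) n :
  size (fps_inv_seq u n) = n.+1.
Proof. by elim: n => //= n IHn; rewrite size_rcons IHn. Qed.

Lemma nth_fps_inv_seq (R : fieldType) (u : fps R) n i :
  (i <= n)%N -> (fps_inv_seq u n)`_i = fps_inv u i.
Proof.
elim: n => [|n IHn]; first by rewrite leqn0 => /eqP->.
rewrite leq_eqVlt => /predU1P[-> //|lt_in].
by rewrite /= nth_rcons size_fps_inv_seq lt_in IHn.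
Qed.

Lemma fps_mulV (R : fieldType) (u : fps R) :
  u 0%N != 0 -> fps_mul u (fps_inv u) =1 fps_one.
Proof.
move=> u0 [|n]; rewrite /fps_mul big_ord_recl /=.
  by rewrite big_ord0 addr0 mulfV.
rewrite subn0 {1}/fps_inv /= nth_rcons size_fps_inv_seq ltnn eqxx.
rewrite mulrA mulrN mulfV // mulN1r; apply/eqP; rewrite addrC subr_eq0.
by apply/eqP/eq_bigr => i _; rewrite nth_fps_inv_seq ?leq_subr.
Qed.

Lemma todd_f_spec (n : nat) :
  fps_mul (fun k => fps_exp 1 k - fps_one k) todd_f n = (n == 1%N)%:R.
Proof.
have e0 : fps_exp 1 0 - fps_one 0 = 0 by [].
rewrite /fps_mul big_ord_recl e0 mul0r add0r.
case: n => [|n]; first by rewrite big_ord0.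
rewrite eqSS -[RHS]/(fps_one n : rat) -(@fps_mulV _ (fun k => fps_exp 1 k.+1)) //.
by apply: eq_bigr => i _; rewrite subr0.
Qed.

(* Straight-line programs over a field F.  The memory is a sequence of field
   elements, initially the inputs; every instruction appends one element to it,
   and its arguments are positions in the memory. *)

Inductive instr (F : Type) :=
  | Const of F
  | Add of nat & nat
  | Sub of nat & nat
  | Mul of nat & nat
  | Inv of nat.
Arguments Add {F}.
Arguments Sub {F}.
Arguments Mul {F}.
Arguments Inv {F}.

Record slp (F : Type) := Slp { code : seq (instr F); outputs : seq nat }.

Definition value {F : fieldType} (s : seq F) (i : instr F) : F :=
  match i with
  | Const c => c
  | Add j k => s`_j + s`_k
  | Sub j k => s`_j - s`_k
  | Mul j k => s`_j * s`_k
  | Inv j => (s`_j)^-1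
  end.

(* Only 0, 1 and the elements of K may be loaded as constants, and only nonzero
   elements may be inverted. *)
Definition admissible {F : fieldType} (K : {pred F}) (s : seq F)
    (i : instr F) : bool :=
  match i with
  | Const c => [|| c == 0, c == 1 | c \in K]
  | Inv j => s`_j != 0
  | _ => true
  end.

Fixpoint run {F : fieldType} (K : {pred F}) (s : seq F) (l : seq (instr F)) :
    option (seq F) :=
  if l is i :: l' then
    if admissible K s i then run K (rcons s (value s i)) l' else None
  else Some s.

Definition slp_eval {F : fieldType} (K : {pred F}) (P : slp F) (x : seq F) :
    option (seq F) :=
  omap (fun s => [seq s`_j | j <- outputs P]) (run K x (code P)).

(* Arithmetic operations have unit cost, loading a constant is free. *)
Definition is_op {F : Type} (i : instr F) : bool :=
  if i is Const _ then false else true.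

Definition slp_cost {F : Type} (P : slp F) : nat := count is_op (code P).

(* Floor of the base 2 logarithm; log2 1 = 0, and for n >= 2 it agrees with the
   real logarithm up to bounded factors. *)
Definition log2 (n : nat) : nat := trunc_log 2 n.

(* P multiplies any two polynomials of degree less than n, given and returned
   by their coefficients, constant term first. *)
Definition multiplies {F : fieldType} (K : {pred F}) (n : nat) (P : slp F) :=
  forall u v : seq F, size u = n -> size v = n ->
    slp_eval K P (u ++ v)
    = Some (mkseq (fun k => (Poly u * Poly v)`_k) (n.*2.-1)).

(* Products of polynomials of degree less than n cost at most c n log n, for
   all n from 2 to d.  The set K holds the scalars the fast Fourier transform
   needs, such as roots of unity. *)
Definition fast_multiplication {F : fieldType} (K : {pred F}) (c d : nat) :=
  forall n : nat, (1 < n <= d)%N ->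
    exists2 P : slp F, multiplies K n P & (slp_cost P <= c * (n * log2 n))%N.

(* x is the sequence q modulo p: the entries of q have denominators prime to p,
   and ratr reduces them to the field 'F_p. *)
Definition reduction_mod (p : nat) (q : seq rat) (x : seq 'F_p) : Prop :=
  all (fun r => ~~ (p %| `|denq r|)%N) q /\ x = map ratr q.

(* Main.v *)
Require Import Defs.
From mathcomp Require Import all_boot all_order all_algebra.
From mathcomp Require Import ring zify.

(* Since e^(bs/2) f(bs) = (bs/2) / sinh(bs/2), the choice of a makes the
   logarithmic derivative H = s F'/F equal to the sum over k >= 2 of
   f_k (p_k(B') - p_k(B)) s^k, where f = sum f_k s^k and p_k is the k-th power
   sum.  The power sums are the coefficients of the logarithmic derivative of
   prod (1 - b s), and this product, modulo s^d, is found by divide and conquer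
   in log^2 d operations per factor.  The series f is the inverse of
   (e^s - 1) / s, and F is recovered from H by solving the differential
   equation s F' = H F.  Inverses and this equation are computed by Newton
   iteration, in O(d log d) operations since the precision doubles at each
   step.  All denominators that occur are products of integers in [1, d], hence
   prime to p. *)

Set Implicit Arguments.
Unset Strict Implicit.
Unset Printing Implicit Defensive.

Import Order.TTheory GRing.Theory Num.Theory.
Local Open Scope ring_scope.

(** * Straight-line programs *)

(** Addresses of a program moved into a larger memory: those below [size pos] name its inputs, now
    found at the positions [pos]; the others name its own results, now appended from [base] on. *)
Definition reloc (pos : seq nat) (base j : nat) : nat :=
  if (j < size pos)%N then nth 0%N pos j else (base + (j - size pos))%N.

Definition reloc_instr {F : Type} (pos : seq nat) (base : nat) (i : instr F) :=
  let r := reloc pos base in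
  match i with
  | Const c => Const c
  | Add j k => Add (r j) (r k)
  | Defs.Sub j k => Defs.Sub (r j) (r k)
  | Mul j k => Mul (r j) (r k)
  | Inv j => Inv (r j)
  end.

Section Combinators.

Variables (F : fieldType) (K : {pred F}).

Lemma run_cat (s : seq F) l1 l2 :
  run K s (l1 ++ l2) = obind (fun s' => run K s' l2) (run K s l1).
Proof. by elim: l1 s => //= i l1 IHl s; case: ifP. Qed.

Lemma run_prefix (s s' : seq F) l :
  run K s l = Some s' -> exists2 t, s' = s ++ t & size t = size l.
Proof.
elim: l s => [|i l IHl] s /=; first by case=> <-; exists [::]; rewrite ?cats0.
case: ifP => // _ /IHl[t -> szt].
by exists (value s i :: t); rewrite /= ?szt // cat_rcons.
Qed.

Lemma nth_reloc (pos : seq nat) (M t : seq F) j :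
  all (fun i => i < size M)%N pos ->
  (M ++ t)`_(reloc pos (size M) j) = ([seq M`_i | i <- pos] ++ t)`_j.
Proof.
move=> /all_nthP posM; rewrite /reloc; case: ltnP => lt_j.
  by rewrite !nth_cat size_map lt_j (posM 0%N) // (nth_map 0%N).
by rewrite !nth_cat size_map ltnNge leq_addr ltnNge lt_j addKn.
Qed.

Lemma run_reloc (pos : seq nat) (M s t : seq F) l :
  all (fun i => i < size M)%N pos ->
  run K ([seq M`_i | i <- pos] ++ s) l = Some ([seq M`_i | i <- pos] ++ t) ->
  run K (M ++ s) (map (reloc_instr pos (size M)) l) = Some (M ++ t).
Proof.
move=> posM; elim: l s => [|i l IHl] s /=.
  by case=> /eqP; rewrite eqseq_cat // eqxx => /eqP->.
have -> : admissible K (M ++ s) (reloc_instr pos (size M) i) =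
          admissible K ([seq M`_i | i <- pos] ++ s) i.
  by case: i => //= j; rewrite nth_reloc.
have -> : value (M ++ s) (reloc_instr pos (size M) i) =
          value ([seq M`_i | i <- pos] ++ s) i.
  by case: i => //= *; rewrite !nth_reloc.
by case: ifP => // _; rewrite !rcons_cat => /IHl.
Qed.

Section Computes.

Variable A : Type.
Implicit Types enc f g h : A -> seq F.

(* One program, independent of [a], turns the memory [enc a] into [f a] at cost
   at most [c].  That [enc a] has a fixed size is a premise inside the
   definition, so that the rules below carry no size conditions. *)
Variant computes enc f (c : nat) : Prop :=
  Computes of forall k, (forall a, size (enc a) = k) ->
    exists P : slp F, (slp_cost P <= c)%N /\
      forall a, slp_eval K P (enc a) = Some (f a).

(* A variant where the outputs are read at positions that do exist: reading
   beyond the end of the memory yields 0, and would not be stable under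
   extension of the memory. *)
Lemma computes_inrange enc f c k :
  computes enc f c -> (forall a, size (enc a) = k) ->
  exists l (js : seq nat), [/\ (count is_op l <= c)%N,
    all (fun j => j < k + size l)%N js &
    forall a, exists t, [/\ size t = size l, run K (enc a) l = Some (enc a ++ t)
                       & [seq (enc a ++ t)`_j | j <- js] = f a]].
Proof.
case=> cf szk; have [[l js] [/= le_c evP]] := cf k szk.
(* A free load of 0 creates the cell [k + size l], to which [minn] redirects every read beyond the
   memory, so the default value 0 is kept. *)
exists (rcons l (Const 0)), [seq minn j (k + size l) | j <- js]; split.
- by rewrite -cats1 count_cat /= !addn0.
- by apply/allP=> _ /mapP[j _ ->]; rewrite size_rcons addnS ltnS geq_minr.
move=> a; have := evP a; rewrite /slp_eval /=.
case runl: (run K (enc a) l) => [s|] //= [<-].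
have [t def_s szt] := run_prefix runl; rewrite def_s in runl *.
exists (rcons t 0); rewrite !size_rcons szt -cats1 run_cat runl /= eqxx.
split; rewrite ?rcons_cat // -map_comp; apply: eq_map => j /=.
rewrite -rcons_cat nth_rcons size_cat szk szt.
have [lt_j|le_j] := ltnP j (k + size l); first by rewrite lt_j.
by rewrite ltnn eqxx nth_default // size_cat szk szt.
Qed.

Lemma computesW enc f c c' :
  computes enc f c -> (c <= c')%N -> computes enc f c'.
Proof.
case=> cf le_cc'; split=> k /cf[P [le_c evP]].
by exists P; rewrite (leq_trans le_c).
Qed.

Lemma eq_computes enc f g c : f =1 g -> computes enc f c -> computes enc g c.
Proof.
move=> eq_fg [cf]; split=> k /cf[P [le_c evP]].
by exists P; split=> // a; rewrite evP eq_fg.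
Qed.

Lemma computes_sized enc f c :
  (forall k, (forall a, size (enc a) = k) -> computes enc f c) ->
  computes enc f c.
Proof. by move=> cf; split=> k szk; case: (cf k szk) => /(_ k szk). Qed.

Lemma computes_select enc (js : seq nat) :
  computes enc (fun a => [seq (enc a)`_j | j <- js]) 0.
Proof. by split=> k _; exists (Slp [::] js). Qed.

Lemma computes_refl enc : computes enc enc 0.
Proof.
apply: computes_sized => k szk.
apply: eq_computes (computes_select enc (iota 0 k)) => a.
by rewrite -(szk a); apply: mkseq_nth.
Qed.

(** The second program is relocated behind the first, its inputs being the output positions [js] of
    the first. *)
Lemma computes_trans enc f g c1 c2 :
  computes enc f c1 -> computes f g c2 -> computes enc g (c1 + c2).
Proof.
move=> cf [cg]; split=> k szk; have [l [js [le_l injs run_l]]] := computes_inrange cf szk.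
have szf a : size (f a) = size js.
  by have [t [_ _ <-]] := run_l a; rewrite size_map.
have [[l' js'] [/= le_l' ev_l']] := cg _ szf.
pose r := reloc js (k + size l); pose ri := @reloc_instr F js (k + size l).
exists (Slp (l ++ map ri l') [seq r j | j <- js']); split.
  rewrite /slp_cost /= count_cat leq_add // count_map.
  by apply: leq_trans le_l'; apply: eq_leq; apply: eq_count; case.
move=> a; have [t [szt run_t def_f]] := run_l a.
have := ev_l' a; rewrite /slp_eval /= run_cat run_t /=.
case run_s: (run K (f a) l') => [s|] //= [<-].
have [t' def_s szt'] := run_prefix run_s.
have szM : size (enc a ++ t) = (k + size l)%N by rewrite size_cat szk szt.
have inM : all (fun j => j < size (enc a ++ t))%N js by rewrite szM.
have := @run_reloc js (enc a ++ t) [::] t' l' inM.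
rewrite !cats0 def_f szM def_s in run_s * => /(_ run_s)->.
rewrite /= -map_comp; congr Some; apply: eq_map => j /=.
by rewrite /r -szM nth_reloc // def_f.
Qed.

(** Both programs start from the same inputs: relocation along [iota 0 k] makes the second skip the
    cells written by the first. *)
Lemma computes_cat enc f g c1 c2 :
  computes enc f c1 -> computes enc g c2 ->
  computes enc (fun a => f a ++ g a) (c1 + c2).
Proof.
move=> cf [cg]; split=> k szk; have [l [js [le_l injs run_l]]] := computes_inrange cf szk.
have [[l' js'] [/= le_l' ev_l']] := cg _ szk.
pose r := reloc (iota 0 k) (k + size l).
pose ri := @reloc_instr F (iota 0 k) (k + size l).
exists (Slp (l ++ map ri l') (js ++ [seq r j | j <- js'])); split.
  rewrite /slp_cost /= count_cat leq_add // count_map.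
  by apply: leq_trans le_l'; apply: eq_leq; apply: eq_count; case.
move=> a; have [t [szt run_t def_f]] := run_l a.
have := ev_l' a; rewrite /slp_eval /= run_cat run_t /=.
case run_s: (run K (enc a) l') => [s|] //= [<-].
have [t' def_s szt'] := run_prefix run_s.
have szM : size (enc a ++ t) = (k + size l)%N by rewrite size_cat szk szt.
have inM : all (fun j => j < size (enc a ++ t))%N (iota 0 k).
  by apply/allP=> j; rewrite mem_iota szM /= => /leq_trans-> //; rewrite leq_addr.
have def_enc : [seq (enc a ++ t)`_j | j <- iota 0 k] = enc a.
  rewrite -[RHS](mkseq_nth 0) szk; apply/eq_in_map => j.
  by rewrite mem_iota /= nth_cat szk => ->.
have := @run_reloc (iota 0 k) (enc a ++ t) [::] t' l' inM.
rewrite !cats0 def_enc szM def_s in run_s * => /(_ run_s)->.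
rewrite /= map_cat -map_comp -def_f; congr (Some (_ ++ _)); last first.
  by apply: eq_map => j /=; rewrite /r -szM nth_reloc // def_enc.
apply/eq_in_map => j /(allP injs) lt_j.
by rewrite -szM in lt_j; rewrite [LHS]nth_cat lt_j.
Qed.

(* The extended memory [enc'] is abstract: the rest of the program may only use
   that it still gives access to all that [enc] gives access to. *)
Lemma computes_let enc f g c1 c2 :
  computes enc f c1 ->
  (forall enc', (forall h c, computes enc h c -> computes enc' h c) ->
    computes enc' f 0 -> computes enc' g c2) ->
  computes enc g (c1 + c2).
Proof.
move=> cf cg; apply: computes_sized => k szk.
have [l [js [_ _ run_l]]] := computes_inrange cf szk.
have szf a : size (f a) = size js.
  by have [t [_ _ <-]] := run_l a; rewrite size_map.
pose enc' a := enc a ++ f a.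
have cenc' : computes enc enc' c1.
  by rewrite -[c1]add0n; apply: computes_cat cf; apply: computes_refl.
apply: (computes_trans cenc'); apply: cg.
  move=> h c; rewrite -[c in X in _ -> X]add0n; apply: computes_trans.
  apply: eq_computes (computes_select enc' (iota 0 k)) => a.
  rewrite -[RHS](mkseq_nth 0) szk; apply/eq_in_map => j.
  by rewrite mem_iota /= nth_cat szk => ->.
apply: eq_computes (computes_select enc' (iota k (size js))) => a.
rewrite -[k]addn0 iotaDl -map_comp -[RHS](mkseq_nth 0) szf.
by apply: eq_map => j /=; rewrite nth_cat szk ltnNge leq_addr addKn.
Qed.

Lemma computes_const enc (x : F) :
  [|| x == 0, x == 1 | x \in K] -> computes enc (fun=> [:: x]) 0.
Proof.
move=> Kx; split=> k szk; exists (Slp [:: Const x] [:: k]); split=> // a.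
by rewrite /slp_eval /= Kx /= nth_rcons szk ltnn eqxx.
Qed.

Lemma computes0 enc : computes enc (fun=> [:: 0]) 0.
Proof. by apply: computes_const; rewrite eqxx. Qed.

Lemma computes1 enc : computes enc (fun=> [:: 1]) 0.
Proof. by apply: computes_const; rewrite eqxx orbT. Qed.

(** Cost 0 in the premises means that the arguments are at hand: they are read from memory or are
    constants. *)
Lemma computes_op (I : instr F) (o : F -> F -> F) enc (x y : A -> F) :
  (forall s, admissible K s I) -> (forall u v, value [:: u; v] I = o u v) ->
  is_op I ->
  computes enc (fun a => [:: x a]) 0 -> computes enc (fun a => [:: y a]) 0 ->
  computes enc (fun a => [:: o (x a) (y a)]) 1.
Proof.
move=> admI valI opI cx cy.
apply: (computes_trans (computes_cat cx cy)); split=> k _.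
exists (Slp [:: I] [:: 2%N]); split=> [|a]; first by rewrite /slp_cost /= opI.
by rewrite /slp_eval /= admI /= valI.
Qed.

Lemma computes_add enc (x y : A -> F) :
  computes enc (fun a => [:: x a]) 0 -> computes enc (fun a => [:: y a]) 0 ->
  computes enc (fun a => [:: x a + y a]) 1.
Proof. exact: (@computes_op (Add 0 1)). Qed.

Lemma computes_sub enc (x y : A -> F) :
  computes enc (fun a => [:: x a]) 0 -> computes enc (fun a => [:: y a]) 0 ->
  computes enc (fun a => [:: x a - y a]) 1.
Proof. exact: (@computes_op (Defs.Sub 0 1) (fun u v => u - v)). Qed.

Lemma computes_mul enc (x y : A -> F) :
  computes enc (fun a => [:: x a]) 0 -> computes enc (fun a => [:: y a]) 0 ->
  computes enc (fun a => [:: x a * y a]) 1.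
Proof. exact: (@computes_op (Mul 0 1)). Qed.

Lemma computes_inv enc (x : A -> F) :
  (forall a, x a != 0) -> computes enc (fun a => [:: x a]) 0 ->
  computes enc (fun a => [:: (x a)^-1]) 1.
Proof.
move=> x0 cx; apply: (computes_trans cx); split=> k _.
exists (Slp [:: Inv 0] [:: 1%N]); split=> // a.
by rewrite /slp_eval /= x0.
Qed.

Lemma computes_mkseq enc (u : A -> nat -> F) n c :
  (forall i, (i < n)%N -> computes enc (fun a => [:: u a i]) c) ->
  computes enc (fun a => mkseq (u a) n) (n * c).
Proof.
elim: n => [|n IHn] cu; first exact: (computes_select enc [::]).
rewrite mulSn addnC.
apply: eq_computes (computes_cat (IHn _) (cu n (leqnn _))) => [a|i lt_i].
  by rewrite cats1 -mkseqS.
by apply: cu; apply: ltnW.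
Qed.

Lemma computes_nth enc (u : A -> nat -> F) n c i :
  computes enc (fun a => mkseq (u a) n) c -> (i < n)%N ->
  computes enc (fun a => [:: u a i]) c.
Proof.
move=> cu lt_i; rewrite -[c]addn0; apply: (computes_trans cu).
apply: eq_computes (computes_select _ [:: i]) => a /=.
by rewrite nth_mkseq.
Qed.

(** Each entry may read all earlier ones from memory, so a recurrence is charged [c] per entry and
    never again for its past. *)
Lemma computes_rec enc (u : A -> nat -> F) n c :
  (forall i enc', (forall h c, computes enc h c -> computes enc' h c) ->
    (i < n)%N -> computes enc' (fun a => mkseq (u a) i) 0 ->
    computes enc' (fun a => [:: u a i]) c) ->
  computes enc (fun a => mkseq (u a) n) (n * c).
Proof.
elim: n => [|n IHn] cu; first exact: (computes_select enc [::]).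
rewrite mulSn addnC; apply: computes_let (IHn _) _ => [i enc' enc'P lt_i|].
  by apply: cu => //; apply: ltnW.
move=> enc' enc'P cu'; rewrite -[c]add0n.
apply: eq_computes (computes_cat cu' (cu n _ enc'P (leqnn _) cu')) => a.
by rewrite cats1 -mkseqS.
Qed.

End Computes.
End Combinators.

(** * Power series modulo powers of the variable *)

Section TruncatedSeries.

Variable F : fieldType.
Implicit Types p q u v g h e : {poly F}.

Lemma dvdXnP n p : reflect (forall k, (k < n)%N -> p`_k = 0) ('X^n %| p).
Proof.
apply: (iffP idP) => [/dvdpP[q ->] k lt_k|p0].
  by rewrite coefMXn lt_k.
rewrite -[p](poly_take_drop n) dvdp_add ?dvdp_mulIr //.
rewrite (_ : take_poly n p = 0) ?dvdp0 //; apply/polyP=> k.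
by rewrite coef_take_poly coef0; case: ifP => // /p0.
Qed.

Lemma dvdXn_leq m n p : (m <= n)%N -> 'X^n %| p -> 'X^m %| p.
Proof. by move=> le_mn; apply: dvdp_trans; apply: dvdp_exp2l. Qed.

Lemma dvdXn_sub_coef n p q :
  'X^n %| p - q -> forall k, (k < n)%N -> p`_k = q`_k.
Proof.
by move=> /dvdXnP eq_pq k /eq_pq /eqP; rewrite coefB subr_eq0 => /eqP.
Qed.

Lemma dvdXn_take n p : 'X^n %| take_poly n p - p.
Proof. by apply/dvdXnP=> k lt_k; rewrite coefB coef_take_poly lt_k subrr. Qed.

Lemma coef_theta p k : ('X * p^`())`_k = k%:R * p`_k.
Proof. by rewrite coefXM coef_deriv mulr_natl; case: k. Qed.

Lemma dvdXn_theta n p : 'X^n %| p -> 'X^n %| 'X * p^`().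
Proof.
by move=> /dvdXnP p0; apply/dvdXnP=> k lt_k; rewrite coef_theta p0 ?mulr0.
Qed.

Definition invp n p := \poly_(i < n) fps_inv (nth 0 p) i.

Lemma mul_invp n p : p`_0 != 0 -> 'X^n %| p * invp n p - 1.
Proof.
move=> p0; apply/dvdXnP=> k lt_k; rewrite coefB coefM coef1.
apply/eqP; rewrite subr_eq0 -[X in _ == X](@fps_mulV F (nth 0 p)) //.
apply/eqP/eq_bigr => i _; rewrite coef_poly.
by rewrite (leq_ltn_trans (leq_subr _ _) lt_k).
Qed.

Lemma inverse_coef0 n p q :
  (0 < n)%N -> p`_0 = 1 -> 'X^n %| p * q - 1 -> q`_0 = 1.
Proof.
move=> n0 p0 /dvdXn_sub_coef /(_ 0%N n0).
by rewrite coefM big_ord1 coef1 p0 mul1r.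
Qed.

(** Up to a multiple of [p * q - 1], the new error is [- p * (v - q) ^+ 2], so the order of
    vanishing doubles. *)
Lemma newton_inverse m n p q v : (n <= m + m)%N ->
  'X^n %| p * q - 1 -> 'X^m %| v - q -> 'X^n %| v + v - v * (p * v) - q.
Proof.
move=> le_n inv_pq eq_vq.
have -> : v + v - v * (p * v) - q
        = (p * q - 1) * (q - (v + v)) - p * ((v - q) * (v - q)) by ring.
apply: dvdp_sub; first exact: dvdp_mulr.
by apply/dvdp_mull/(dvdXn_leq le_n); rewrite exprD; apply: dvdp_mul.
Qed.

(* With theta = X d/dX and [x = v g - 1], one has
   [theta x = (1 + x) (h - g theta u)] modulo [X^n], and both [x] and [h - g theta u] vanish modulo [X^m]. *)
Lemma newton_exp m n h v u g e : (m <= n <= m + m)%N ->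
    'X^n %| 'X * v^`() - h * v -> 'X^m %| u - v -> 'X^n %| u * g - 1 ->
    v`_0 = 1 -> u`_0 = 1 ->
    (forall k, (0 < k < n)%N -> k%:R != 0 :> F) -> e`_0 = 0 ->
    (forall k, (0 < k < n)%N -> e`_k = (h - g * ('X * u^`()))`_k / k%:R) ->
  'X^n %| u + u * e - v.
Proof.
move=> /andP[le_mn le_n] odev eq_uv inv_ug v0 u0 unitk e0 def_e.
set w := u * g - 1 in inv_ug; set r := 'X * v^`() - h * v in odev.
set z := u - v in eq_uv; set D := h - _ in def_e.
pose x := g * v - 1.
have xm : 'X^m %| x.
  have -> : x = w - g * z by rewrite /x /w /z; ring.
  by apply: dvdp_sub; [apply: dvdXn_leq inv_ug | apply: dvdp_mull].
have Dm : 'X^m %| D.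
  have -> : D = g * (z * h - 'X * z^`() - r) - w * h.
    rewrite /D /z /r /w derivB; ring.
  apply: dvdp_sub; last exact/dvdp_mulr/(dvdXn_leq le_mn).
  apply: dvdp_mull; apply: dvdp_sub; last exact: dvdXn_leq odev.
  by apply: dvdp_sub; [apply: dvdp_mulr | apply: dvdXn_theta].
have thetax : 'X^n %| 'X * x^`() - D.
  have -> : 'X * x^`() - D
      = x * D + g * r + g * v * ('X * w^`()) - w * ('X * g^`() * v).
    rewrite /x /D /r /w !derivB !derivM derivC; ring.
  apply: dvdp_sub; last exact: dvdp_mulr.
  apply: dvdp_add; last exact/dvdp_mull/dvdXn_theta.
  apply: dvdp_add; last exact: dvdp_mull.
  by apply: dvdXn_leq le_n _; rewrite exprD; apply: dvdp_mul.
(* It remains to see that [e] agrees with [x] modulo [X^n]: coefficientwise, [theta x = D] reads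
   [k x_k = D_k], which division by [k] solves. *)
have -> : u + u * e - v = u * (e - x) + w * v by rewrite /x /w; ring.
apply: dvdp_add; last exact: dvdp_mulr.
apply/dvdp_mull/dvdXnP=> k lt_k; apply/eqP; rewrite coefB subr_eq0; apply/eqP.
case: (posnP k) => [->|k0].
  have g0 : g`_0 = 1 by exact: (inverse_coef0 (leq_ltn_trans (leq0n _) lt_k) u0 inv_ug).
  by rewrite e0 /x coefB coefM big_ord1 g0 v0 coef1 mulr1 subrr.
rewrite def_e ?k0 // -(dvdXn_sub_coef thetax lt_k) coef_theta mulrC mulKf //.
by rewrite unitk ?k0.
Qed.

End TruncatedSeries.

(** * Logarithmic derivatives of the factors of F and of products of linear factors *)

Section LogarithmicDerivatives.

Variable F : fieldType.
Implicit Types p q h g : {poly F}.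

(** Here [h] stands for [X p' / p]; clearing the denominator avoids inverting [p]. *)
Definition logder n p h := 'X^n %| 'X * p^`() - h * p.

Lemma logder_eq n p h (k : {poly F}) : 'X^n %| h - k -> logder n p h -> logder n p k.
Proof.
rewrite /logder => eq_hk ph.
have -> : 'X * p^`() - k * p = 'X * p^`() - h * p + (h - k) * p by ring.
by rewrite dvdp_add ?dvdp_mulr.
Qed.

Lemma logder_mul n p q h (k : {poly F}) :
  logder n p h -> logder n q k -> logder n (p * q) (h + k).
Proof.
rewrite /logder derivM => ph qk.
have -> : 'X * (p^`() * q + p * q^`()) - (h + k) * (p * q)
        = ('X * p^`() - h * p) * q + p * ('X * q^`() - k * q) by ring.
by apply: dvdp_add; [apply: dvdp_mulr | apply: dvdp_mull].
Qed.

Lemma logder_prod n (T : Type) (s : seq T) (f g : T -> {poly F}) :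
  (forall x, logder n (f x) (g x)) ->
  logder n (\prod_(x <- s) f x) (\sum_(x <- s) g x).
Proof.
move=> fg; elim: s => [|x s IHs].
  by rewrite !big_nil /logder derivC !(mulr0, mul0r) subrr dvdp0.
by rewrite !big_cons; apply: logder_mul.
Qed.

Lemma logder_inv n p q h :
  'X^n %| p * q - 1 -> logder n p h -> logder n q (- h).
Proof.
rewrite /logder => inv_pq ph; set w := p * q - 1 in inv_pq.
have -> : 'X * q^`() - - h * q
  = q * ('X * w^`()) - ('X * p^`() - h * p) * (q * q) - w * ('X * q^`() + h * q).
  by rewrite /w derivB derivM derivC; ring.
apply: dvdp_sub; last exact: dvdp_mulr.
by apply: dvdp_sub; [apply/dvdp_mull/dvdXn_theta | apply: dvdp_mulr].
Qed.

Lemma coef_comp_scale p x i : (p \Po (x *: 'X))`_i = x ^+ i * p`_i.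
Proof.
rewrite comp_polyE coef_sum.
under eq_bigr do rewrite exprZn !coefZ coefXn.
have [lt_i|le_i] := ltnP i (size p).
  rewrite (bigD1 (Ordinal lt_i)) //= eqxx mulr1 mulrC big1 ?addr0 // => j neq_j.
  by rewrite [_ == _](_ : _ = false) ?mulr0 // eq_sym; apply/negbTE.
rewrite nth_default // mulr0 big1 // => j _.
by rewrite [_ == _](_ : _ = false) ?mulr0 //; have := ltn_ord j; lia.
Qed.

Lemma dvdXn_comp_scale n p x : 'X^n %| p -> 'X^n %| p \Po (x *: 'X).
Proof.
by move=> /dvdXnP p0; apply/dvdXnP=> k /p0 pk; rewrite coef_comp_scale pk mulr0.
Qed.

Lemma logder_scale n p h x :
  logder n p h -> logder n (p \Po (x *: 'X)) (h \Po (x *: 'X)).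
Proof.
move/(dvdXn_comp_scale x); rewrite /logder comp_polyB !comp_polyM comp_polyX.
suff -> : 'X * (p \Po (x *: 'X))^`() = x *: 'X * (p^`() \Po (x *: 'X)) by [].
by rewrite deriv_comp derivZ derivX -!mul_polyC; ring.
Qed.

Definition exp_poly n x : {poly F} := \poly_(i < n) (x ^+ i / i`!%:R).

Lemma logder_exp n x : (forall k, (0 < k < n)%N -> k%:R != 0 :> F) ->
  logder n (exp_poly n x) (x *: 'X).
Proof.
move=> unitk; apply/dvdXnP=> k lt_k.
rewrite coefB coef_theta -scalerAl coefZ coefXM !coef_poly lt_k.
case: k => [|k] /= in lt_k *; first by rewrite mul0r mulr0 subrr.
rewrite (ltnW lt_k) factS natrM invfM mulrCA mulVKf ?unitk //.
by rewrite exprS mulrA subrr.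
Qed.

(* The series (e^s - 1) / s, whose inverse is f(s). *)
Definition expm1_poly n : {poly F} := \poly_(i < n) (i.+1)`!%:R^-1.
Definition todd_poly n := invp n (expm1_poly n).

Lemma expm1_poly0 n : (0 < n)%N -> (expm1_poly n)`_0 = 1.
Proof. by move=> n0; rewrite coef_poly n0 invr1. Qed.

Lemma todd_polyP n : (0 < n)%N -> 'X^n %| expm1_poly n * todd_poly n - 1.
Proof. by move=> n0; apply: mul_invp; rewrite expm1_poly0 ?oner_neq0. Qed.

Lemma todd_poly0 n : (0 < n)%N -> (todd_poly n)`_0 = 1.
Proof.
by move=> n0; apply: inverse_coef0 n0 (expm1_poly0 n0) (todd_polyP n0).
Qed.

Lemma todd_poly1 n : (1 < n)%N -> (todd_poly n)`_1 = - 2%:R^-1.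
Proof.
move=> n1; have := dvdXn_sub_coef (todd_polyP (ltnW n1)) n1.
rewrite coefM !big_ord_recl big_ord0 /= coef1 subn0 subnn addr0 /bump /=.
have -> : (expm1_poly n)`_1 = 2%:R^-1 by rewrite coef_poly n1.
rewrite expm1_poly0 ?todd_poly0 ?(ltnW n1) // mul1r mulr1.
by move/eqP; rewrite addr_eq0 => /eqP.
Qed.

(** The series [E = (e^s - 1) / s] satisfies [s E' + E = (s E)' = e^s = 1 + s E], so its logarithmic
    derivative is [s - 1 + 1 / E]; passing to the inverse changes the sign. The index [k = n] must
    be invertible because [E] modulo [s^n] involves [1 / n!]. *)
Lemma logder_todd n : (0 < n)%N -> (forall k, (0 < k <= n)%N -> k%:R != 0 :> F) ->
  logder n (todd_poly n) (1 - 'X - todd_poly n).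
Proof.
move=> n0 unitk; have inv_todd := todd_polyP n0.
suff : logder n (expm1_poly n) ('X - 1 + todd_poly n).
  by move/(logder_inv inv_todd); congr (logder _ _ _); ring.
have -> : logder n (expm1_poly n) ('X - 1 + todd_poly n) =
  ('X^n %| ('X * (expm1_poly n)^`() + expm1_poly n - 'X * expm1_poly n - 1)
           - (expm1_poly n * todd_poly n - 1)).
  by rewrite /logder; congr (_ %| _); ring.
apply: dvdp_sub => //; apply/dvdXnP=> k lt_k.
rewrite !coefB coefD coef_theta coefXM !coef_poly coef1 lt_k.
case: k lt_k => [|k] lt_k /=; first by rewrite mul0r add0r subr0 invr1 subrr.
rewrite (ltnW lt_k) subr0 -[X in _ + X - _]mul1r -mulrDl natr1.
by rewrite [(k.+2)`!]factS natrM invfM mulVKf ?subrr ?unitk.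
Qed.

(** The constant coefficient is 0 rather than the number of entries, since a logarithmic derivative
    has no constant term. *)
Definition powersums n (s : seq F) : {poly F} :=
  \poly_(i < n) (if i == 0%N then 0 else \sum_(x <- s) x ^+ i).

Lemma coef_powersums n s i :
  (0 < i < n)%N -> (powersums n s)`_i = \sum_(x <- s) x ^+ i.
Proof. by case: i => // i /= lt_i; rewrite coef_poly lt_i. Qed.

Definition linprod (s : seq F) : {poly F} := \prod_(x <- s) (1 - x *: 'X).

Lemma linprod0 s : (linprod s)`_0 = 1.
Proof.
rewrite -horner_coef0 horner_prod big1 // => x _.
by rewrite !hornerE ?mulr0 ?subr0.
Qed.

(** A factor [1 - x X] contributes [- x X / (1 - x X)], a geometric series, and the contributions
    add up. *)
Lemma logder_linprod n s : logder n (linprod s) (- powersums n s).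
Proof.
have : logder n (linprod s)
    (\sum_(x <- s) - \poly_(i < n) (if i == 0%N then 0 else x ^+ i)).
  apply: logder_prod => x; apply/dvdXnP=> k lt_k.
  set q := \poly_(i < n) _.
  have -> : - q * (1 - x *: 'X) = x *: ('X * q) - q.
    by rewrite -!mul_polyC; ring.
  rewrite derivB derivC derivZ derivX sub0r !coefB coefZ coefXM.
  rewrite coefN coefZ coef1 coefXM !coef_poly lt_k.
  case: k lt_k => [|[|k]] lt_k /=; first by rewrite mulr0 !subr0.
    by rewrite (ltnW lt_k) mulr0 mulr1 sub0r opprK addNr.
  by rewrite (ltnW lt_k) -exprS mulr0 oppr0 !subrr.
apply: logder_eq; rewrite sumrN opprK addrC -dvdpNr opprB.
apply/dvdXnP=> k lt_k; rewrite coefB coef_sum coef_poly lt_k.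
under eq_bigr do rewrite coef_poly lt_k.
by case: eqP => _; rewrite ?subrr ?big1 ?subrr.
Qed.

(** The analogue over [F] of F(s; a, B, B') modulo [s^n], with [x] in the role of [a]. *)
Definition todd_class n (x : F) (s s' : seq F) : {poly F} :=
  exp_poly n x * (\prod_(y <- s) (todd_poly n \Po (y *: 'X)) *
    \prod_(y <- s') invp n (todd_poly n \Po (y *: 'X))).

Definition todd_logder n (s s' : seq F) : {poly F} :=
  \poly_(i < n) (if (i < 2)%N then 0
                 else (todd_poly n)`_i * (powersums n s' - powersums n s)`_i).

Lemma todd_class0 n x s s' : (0 < n)%N -> (todd_class n x s s')`_0 = 1.
Proof.
move=> n0; have todd0 y : (todd_poly n \Po (y *: 'X))`_0 = 1.
  by rewrite coef_comp_scale mul1r todd_poly0.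
rewrite -horner_coef0 !hornerM !horner_prod !big1 => [|y _|y _].
- by rewrite horner_coef0 coef_poly n0 !mulr1 divr1.
- rewrite horner_coef0 (inverse_coef0 n0 (todd0 y)) //.
  by apply: mul_invp; rewrite todd0 oner_neq0.
- by rewrite horner_coef0 todd0.
Qed.

(* The factor e^(x s) cancels the coefficient of degree 1. *)
Lemma logder_todd_class n x s s' : (1 < n)%N ->
  (forall k, (0 < k <= n)%N -> k%:R != 0 :> F) ->
  x = (\sum_(y <- s) y - \sum_(y <- s') y) / 2%:R ->
  logder n (todd_class n x s s') (todd_logder n s s').
Proof.
move=> n1 unitk def_x; have n0 := ltnW n1.
pose l y := (1 - 'X - todd_poly n) \Po (y *: 'X).
have ltodd y : logder n (todd_poly n \Po (y *: 'X)) (l y).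
  exact/logder_scale/logder_todd.
have linv y : logder n (invp n (todd_poly n \Po (y *: 'X))) (- l y).
  apply: logder_inv (ltodd y); apply: mul_invp.
  by rewrite coef_comp_scale mul1r todd_poly0 ?oner_neq0.
have lexp : logder n (exp_poly n x) (x *: 'X).
  apply: logder_exp => k /andP[k0 lt_k].
  by apply: unitk; rewrite k0 (ltnW lt_k).
apply: logder_eq (logder_mul lexp
  (logder_mul (logder_prod s ltodd) (logder_prod s' linv))).
have n2 : 2%:R != 0 :> F by rewrite unitk.
apply/dvdXnP=> k lt_k.
rewrite coefB !coefD !coef_sum coefZ coefX [(todd_logder _ _ _)`_k]coef_poly lt_k.
under eq_bigr do rewrite coef_comp_scale.
under [X in _ + (_ + X) - _]eq_bigr do rewrite coefN coef_comp_scale.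
rewrite sumrN -!mulr_suml !coefB coef1 coefX.
(* The series [1 - X - f] has coefficients [1 - f_0 = 0], then [- 1 - f_1 = - 1/2], which the choice
   of [x] compensates, then [- f_k]. *)
case: k lt_k => [|[|k]] lt_k /=.
- by rewrite todd_poly0 //; ring.
- rewrite todd_poly1 // def_x.
  by under eq_bigr do rewrite expr1;
  under [X in - (X * _)]eq_bigr do rewrite expr1; field.
- by rewrite !coef_powersums //; ring.
Qed.

End LogarithmicDerivatives.

(** * Fast algorithms on truncated power series *)

Definition vec {F : fieldType} n (p : {poly F}) := mkseq (fun i => p`_i) n.

Section Routines.

Variables (F : fieldType) (K : {pred F}) (A : Type).
Implicit Types (enc : A -> seq F) (p q : A -> {poly F}).

Local Notation computes := (@computes F K A).

Lemma computes_vec_coef enc p n c i :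
  computes enc (fun a => vec n (p a)) c -> (i < n)%N ->
  computes enc (fun a => [:: (p a)`_i]) c.
Proof. exact: (@computes_nth _ _ _ enc (fun a i => (p a)`_i)). Qed.

(** Truncating drops outputs and padding loads the constant 0; both are free. *)
Lemma computes_vec_resize enc p m n c :
  computes enc (fun a => vec m (p a)) c ->
  (forall a k, (m <= k < n)%N -> (p a)`_k = 0) ->
  computes enc (fun a => vec n (p a)) c.
Proof.
move=> cp p0; rewrite -[c]addn0; apply: (computes_trans cp).
rewrite -(muln0 n); apply: computes_mkseq => k lt_k.
have [lt_km|le_mk] := ltnP k m.
  exact: computes_vec_coef (computes_refl _ _) lt_km.
by apply: eq_computes (computes0 _ _) => a; rewrite p0 ?le_mk.
Qed.

Lemma computes_vec_take enc p m n c : (m <= n)%N ->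
  computes enc (fun a => vec n (p a)) c ->
  computes enc (fun a => vec m (p a)) c.
Proof. by move=> le_mn /computes_vec_resize; apply=> a k; lia. Qed.

Lemma computes_vec_eq enc p q n c :
  (forall a, 'X^n %| p a - q a) -> computes enc (fun a => vec n (p a)) c ->
  computes enc (fun a => vec n (q a)) c.
Proof.
move=> eq_pq; apply: eq_computes => a; apply/eq_in_map => k.
by rewrite mem_iota => /(dvdXn_sub_coef (eq_pq a)).
Qed.

Lemma computes_vec_take_poly enc p m n c :
  computes enc (fun a => vec m (p a)) c ->
  computes enc (fun a => vec n (take_poly m (p a))) c.
Proof.
move=> cp; apply: (@computes_vec_resize _ _ m) => [|a k /andP[le_mk _]].
  apply: computes_vec_eq cp => a.
  by rewrite -dvdpNr opprB dvdXn_take.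
by rewrite coef_take_poly ltnNge le_mk.
Qed.

Lemma computes_vec_add enc p q n :
  computes enc (fun a => vec n (p a)) 0 ->
  computes enc (fun a => vec n (q a)) 0 ->
  computes enc (fun a => vec n (p a + q a)) n.
Proof.
move=> cp cq; rewrite -[X in computes _ _ X]muln1.
apply: computes_mkseq => k lt_k.
apply: (eq_computes (f := fun a => [:: (p a)`_k + (q a)`_k])) => [a|].
  by rewrite coefD.
by apply: computes_add; [apply: computes_vec_coef cp _ | apply: computes_vec_coef cq _].
Qed.

Lemma computes_vec_sub enc p q n :
  computes enc (fun a => vec n (p a)) 0 ->
  computes enc (fun a => vec n (q a)) 0 ->
  computes enc (fun a => vec n (p a - q a)) n.
Proof.
move=> cp cq; rewrite -[X in computes _ _ X]muln1.
apply: computes_mkseq => k lt_k.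
apply: (eq_computes (f := fun a => [:: (p a)`_k - (q a)`_k])) => [a|].
  by rewrite coefB.
by apply: computes_sub; [apply: computes_vec_coef cp _ | apply: computes_vec_coef cq _].
Qed.

Lemma computes_theta enc p n :
  computes enc (fun a => vec n (p a)) 0 ->
  computes enc (fun=> mkseq (fun i => i%:R) n) 0 ->
  computes enc (fun a => vec n ('X * (p a)^`())) n.
Proof.
move=> cp cn; rewrite -[X in computes _ _ X]muln1.
apply: computes_mkseq => k lt_k.
apply: (eq_computes (f := fun a => [:: k%:R * (p a)`_k])) => [a|].
  by rewrite coef_theta.
apply: computes_mul; last exact: computes_vec_coef cp _.
exact: (computes_nth (u := fun _ i => i%:R) cn).
Qed.

Lemma uphalf_bounds n : (1 < n)%N ->
  [/\ (0 < uphalf n)%N, (uphalf n < n)%N, (n <= uphalf n + uphalf n)%N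
    & (3 * uphalf n <= 2 * n)%N].
Proof. by move=> n1; split; lia. Qed.

(** Since [uphalf n] is at most [2n/3] for [n >= 2], the recurrence T(n) = T(uphalf n) + b n log n
    is solved by 3 b n log n. *)
Lemma halving_cost b n : (1 < n)%N ->
  (3 * b * (uphalf n * log2 (uphalf n)) + b * (n * log2 n)
   <= 3 * b * (n * log2 n))%N.
Proof.
move=> /uphalf_bounds[_ lt_n _ le3].
have le_log : (log2 (uphalf n) <= log2 n)%N by apply: leq_trunc_log; apply: ltnW.
have : (b * (3 * uphalf n * log2 (uphalf n)) <= b * (2 * n * log2 n))%N.
  by rewrite leq_mul2l leq_mul ?orbT.
by lia.
Qed.

Lemma log2_gt0 n : (1 < n)%N -> (0 < log2 n)%N.
Proof. by move=> n1; rewrite trunc_log_gt0. Qed.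

Lemma leq_nlog n : (1 < n)%N -> (n <= n * log2 n)%N.
Proof. by move=> /log2_gt0 log0; rewrite leq_pmulr. Qed.

Variables (c d : nat).
Hypothesis fastmul : fast_multiplication K c d.

Lemma computes_vec_mul enc p q n c1 c2 : (1 < n <= d)%N ->
  computes enc (fun a => vec n (p a)) c1 ->
  computes enc (fun a => vec n (q a)) c2 ->
  computes enc (fun a => vec n (p a * q a)) (c1 + c2 + c * (n * log2 n)).
Proof.
move=> n_d cp cq; have [P mulP costP] := fastmul n_d.
apply: (computes_trans (computes_cat cp cq)); rewrite -[X in computes _ _ X]addn0.
(* The program multiplies the truncations; the first [n] of its [n.*2.-1] outputs agree with those
   of the full product. *)
pose r a := Poly (vec n (p a)) * Poly (vec n (q a)).
apply: (@computes_trans _ _ _ _ (fun a => vec n.*2.-1 (r a))).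
  by split=> k _; exists P; split=> // a; rewrite mulP ?size_mkseq.
apply: (computes_vec_eq (p := r)); last first.
  by apply: computes_vec_take (computes_refl _ _); lia.
move=> a; apply/dvdXnP=> k lt_k; apply/eqP; rewrite coefB subr_eq0 !coefM.
apply/eqP/eq_bigr=> i _; rewrite !coef_Poly !nth_mkseq //.
  exact: leq_ltn_trans (leq_subr _ _) lt_k.
by apply: leq_ltn_trans lt_k; rewrite -ltnS.
Qed.

Lemma computes_vec_mul_avail enc p q n : (1 < n <= d)%N ->
  computes enc (fun a => vec n (p a)) 0 ->
  computes enc (fun a => vec n (q a)) 0 ->
  computes enc (fun a => vec n (p a * q a)) (c * (n * log2 n)).
Proof. by move=> n_d cp cq; apply: computes_vec_mul n_d cp cq. Qed.

(** A Newton step from precision [uphalf n] takes two products, one sum and one difference, at most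
    [(2c + 2) n log n]; [halving_cost] supplies the factor 3. *)
Lemma computes_inverse n enc p q : (0 < n <= d)%N ->
  (forall a, (p a)`_0 = 1) -> (forall a, 'X^n %| p a * q a - 1) ->
  computes enc (fun a => vec n (p a)) 0 ->
  computes enc (fun a => vec n (q a)) (3 * (2 * c + 2) * (n * log2 n)).
Proof.
elim/ltn_ind: n enc => n IHn enc /andP[n0 le_nd] p0 inv_pq cp.
have [n1|n1] := leqP n 1.
  apply: computesW (leq0n _); have -> : n = 1%N by lia.
  apply: eq_computes (computes1 _ _) => a; rewrite /vec /mkseq /=.
  by rewrite (inverse_coef0 n0 (p0 a) (inv_pq a)).
have [m0 lt_mn le_n _] := uphalf_bounds n1; set m := uphalf n in m0 lt_mn le_n.
pose v a := take_poly m (q a).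
apply: computesW (halving_cost _ n1); rewrite -/m.
apply: (@computes_let _ _ _ _ (fun a => vec n (v a))).
  apply: computes_vec_take_poly; apply: IHn => //; first by lia.
    by move=> a; apply: dvdXn_leq (inv_pq a); apply: ltnW.
  by apply: computes_vec_take cp; apply: ltnW.
move=> enc1 enc1P cv; have cost_n := leq_nlog n1.
have n_d : (1 < n <= d)%N by rewrite n1.
apply: (@computesW _ _ _ _ _ (c * (n * log2 n) + (c * (n * log2 n) + (n + n)))%N);
  last by lia.
apply: (@computes_let _ _ _ _ (fun a => vec n (p a * v a))).
  by apply: (computes_vec_mul_avail n_d _ cv); apply: enc1P.
move=> enc2 enc2P cpv.
apply: (@computes_let _ _ _ _ (fun a => vec n (v a * (p a * v a)))).
  by apply: (computes_vec_mul_avail n_d _ cpv); apply: enc2P.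
move=> enc3 enc3P cvpv.
apply: (@computes_let _ _ _ _ (fun a => vec n (v a + v a))).
  by apply: computes_vec_add; apply/enc3P/enc2P.
move=> enc4 enc4P cvv.
apply: computes_vec_eq (computes_vec_sub cvv (enc4P _ _ cvpv)) => a.
by apply: newton_inverse le_n (inv_pq a) (dvdXn_take _ _).
Qed.

(** A step takes an inverse computed afresh ([6c + 6]), two products ([2c]) and four linear passes,
    which gives [8c + 10], again tripled by [halving_cost]. The integers and their inverses are
    tabulated beforehand and shared by all levels. *)
Lemma computes_exp n enc (h v : A -> {poly F}) : (0 < n <= d)%N ->
  (forall k, (0 < k < n)%N -> k%:R != 0 :> F) ->
  (forall a, (v a)`_0 = 1) ->
  (forall a, 'X^n %| 'X * (v a)^`() - h a * v a) ->
  computes enc (fun a => vec n (h a)) 0 ->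
  computes enc (fun=> mkseq (fun i => i%:R) n) 0 ->
  computes enc (fun=> mkseq (fun i => (i%:R)^-1) n) 0 ->
  computes enc (fun a => vec n (v a)) (3 * (8 * c + 10) * (n * log2 n)).
Proof.
elim/ltn_ind: n enc => n IHn enc /andP[n0 le_nd] unitk v0 odev ch cnat cinv.
have [n1|n1] := leqP n 1.
  apply: computesW (leq0n _); have -> : n = 1%N by lia.
  by apply: eq_computes (computes1 _ _) => a; rewrite /vec /mkseq /= v0.
have [m0 lt_mn le_n _] := uphalf_bounds n1; set m := uphalf n in m0 lt_mn le_n.
pose u a := take_poly m (v a).
have u0 a : (u a)`_0 = 1 by rewrite coef_take_poly m0 v0.
apply: computesW (halving_cost _ n1); rewrite -/m.
apply: (@computes_let _ _ _ _ (fun a => vec n (u a))).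
  apply: computes_vec_take_poly; apply: IHn => //; first by lia.
  - by move=> k /andP[k0 lt_k]; rewrite unitk ?k0 ?(ltn_trans lt_k).
  - by move=> a; apply: dvdXn_leq (odev a); apply: ltnW.
  - by apply: computes_vec_take ch; apply: ltnW.
  - rewrite -(muln0 m); apply: computes_mkseq => i lt_i.
    exact: (computes_nth (u := fun _ i => i%:R) cnat (ltn_trans lt_i lt_mn)).
  - rewrite -(muln0 m); apply: computes_mkseq => i lt_i.
    exact: (computes_nth (u := fun _ i => (i%:R)^-1) cinv (ltn_trans lt_i lt_mn)).
move=> enc1 enc1P cu; have cost_n := leq_nlog n1.
have n_d : (1 < n <= d)%N by rewrite n1.
pose g a := invp n (u a).
have inv_ug a : 'X^n %| u a * g a - 1.
  by apply: mul_invp; rewrite u0 oner_neq0.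
apply: (@computesW _ _ _ _ _ (3 * (2 * c + 2) * (n * log2 n) + (n +
  (c * (n * log2 n) + (n + (n + (c * (n * log2 n) + n))))))%N); last by lia.
apply: (@computes_let _ _ _ _ (fun a => vec n (g a))).
  by apply: computes_inverse cu => //; rewrite n0.
move=> enc2 enc2P cg.
apply: (@computes_let _ _ _ _ (fun a => vec n ('X * (u a)^`()))).
  by apply: computes_theta; [apply: enc2P | apply/enc2P/enc1P].
move=> enc3 enc3P cthu.
apply: (@computes_let _ _ _ _ (fun a => vec n (g a * ('X * (u a)^`())))).
  by apply: (computes_vec_mul_avail n_d _ cthu); apply: enc3P.
move=> enc4 enc4P cgthu.
pose D a := h a - g a * ('X * (u a)^`()).
apply: (@computes_let _ _ _ _ (fun a => vec n (D a))).
  by apply: computes_vec_sub => //; apply/enc4P/enc3P/enc2P/enc1P.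
move=> enc5 enc5P cD.
(* At index 0 the convention [0^-1 = 0] makes the constant coefficient vanish, as [newton_exp]
   requires. *)
pose e a := \poly_(i < n) ((D a)`_i * (i%:R)^-1).
apply: (@computes_let _ _ _ _ (fun a => vec n (e a))).
  rewrite -[X in computes _ _ X]muln1; apply: computes_mkseq => k lt_k.
  apply: (eq_computes (f := fun a => [:: (D a)`_k * (k%:R)^-1])) => [a|].
    by rewrite coef_poly lt_k.
  apply: computes_mul; first exact: computes_vec_coef cD _.
  apply: (computes_nth (u := fun _ i => (i%:R)^-1) _ lt_k).
  exact/enc5P/enc4P/enc3P/enc2P/enc1P.
move=> enc6 enc6P ce.
have cu6 : computes enc6 (fun a => vec n (u a)) 0.
  exact/enc6P/enc5P/enc4P/enc3P/enc2P.
apply: (@computes_let _ _ _ _ (fun a => vec n (u a * e a))).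
  exact: (computes_vec_mul_avail n_d cu6 ce).
move=> enc7 enc7P cue.
apply: computes_vec_eq (computes_vec_add (enc7P _ _ cu6) cue) => a.
apply: newton_exp (odev a) (dvdXn_take _ _) (inv_ug a) _ _ unitk _ _ => //.
- by rewrite (ltnW lt_mn).
- exact: u0.
- by rewrite coef_poly n0 invr0 mulr0.
- by move=> k /andP[k0 lt_k]; rewrite coef_poly lt_k.
Qed.

End Routines.

(** * Power sums by divide and conquer, and the complete algorithm *)

Section ToddAlgorithm.

Variables (F : fieldType) (K : {pred F}) (A : Type) (c d : nat).
Hypothesis fastmul : fast_multiplication K c d.
Hypothesis d_gt1 : (1 < d)%N.
Hypothesis unitk : forall k, (0 < k <= d)%N -> k%:R != 0 :> F.
Implicit Types (enc : A -> seq F).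

Local Notation computes := (@computes F K A).

Lemma size_prod_linear m i0 (x : nat -> F) :
  (size (\prod_(i0 <= i < i0 + m) (1 - x i *: 'X))%R <= m.+1)%N.
Proof.
elim: m => [|m IHm]; first by rewrite addn0 big_geq ?size_poly1.
rewrite addnS big_nat_recr ?leq_addr //=.
apply: leq_trans (size_polyMleq _ _) _.
have le2 : (size (1 - x (i0 + m)%N *: 'X)%R <= 2)%N.
  rewrite (leq_trans (size_polyD _ _)) // size_polyN geq_max size_poly1.
  by rewrite (leq_trans (size_scale_leq _ _)) ?size_polyX.
by rewrite -subn1 leq_subLR (leq_trans (leq_add IHm le2)) // addn2.
Qed.

(* Splitting off 2 ^ j factors, rather than half of them, keeps the bound linear
   in m at each of the j levels. *)
Lemma computes_prod_level enc (x : A -> nat -> F) j m i0 : (m <= 2 ^ j)%N ->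
  (forall i, (i0 <= i < i0 + m)%N -> computes enc (fun a => [:: x a i]) 0) ->
  computes enc (fun a => vec d (\prod_(i0 <= i < i0 + m) (1 - x a i *: 'X)))
    ((2 * c + 1) * (m * j.+1 * log2 d)).
Proof.
have log_d := log2_gt0 d_gt1.
elim: j m i0 => [|j IHj] m i0 le_m cx.
  have [m0|m0] := posnP m.
    rewrite m0 muln0; apply: (@computes_vec_resize _ _ _ _ _ 1) => [|a k k1].
      apply: eq_computes (computes1 _ _) => a.
      by rewrite addn0 big_geq // /vec /mkseq /= coef1.
    by rewrite addn0 big_geq // coef1; case: k k1.
  have -> : m = 1%N by move: le_m; rewrite expn0; lia.
  apply: (@computesW _ _ _ _ _ 1); last by rewrite !muln1; nia.
  apply: (@computes_vec_resize _ _ _ _ _ 2) => [|a k k2].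
    pose f a : seq F := [:: 1] ++ [:: 0 - x a i0].
    apply: (eq_computes (f := f)) => [a|].
      rewrite /f addn1 big_nat1 /vec /mkseq /= !coefB !coef1 !coefZ !coefX.
      by rewrite mulr0 mulr1 subr0.
    rewrite -[1%N]add0n; apply: computes_cat; first exact: computes1.
    by apply: computes_sub; [apply: computes0 | apply: cx; lia].
  rewrite addn1 big_nat1 coefB coef1 coefZ coefX.
  by case: k k2 => [|[|k]] //= _; rewrite mulr0 subr0.
have [le_mj|lt_jm] := leqP m (2 ^ j).
  by apply: computesW (IHj m i0 le_mj cx) _; rewrite !leq_mul.
set m1 := (2 ^ j)%N in lt_jm; have m1_gt0 : (0 < m1)%N by rewrite expn_gt0.
have cl := IHj m1 i0 (leqnn _).
have cr := IHj (m - m1)%N (i0 + m1)%N.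
pose l a := \prod_(i0 <= i < i0 + m1) (1 - x a i *: 'X).
pose r a := \prod_(i0 + m1 <= i < i0 + m1 + (m - m1)) (1 - x a i *: 'X).
have def_lr a : \prod_(i0 <= i < i0 + m) (1 - x a i *: 'X) = l a * r a.
  by rewrite /l /r -addnA subnKC ?(ltnW lt_jm) //
     -big_cat_nat ?leq_addr // leq_add2l ltnW.
(* The product has at most [m.+1] coefficients, so the multiplication is done at this length, capped
   at [d], and zeros fill the rest. *)
pose n := minn m.+1 d.
apply: (@computes_vec_resize _ _ _ _ _ n) => [|a k /andP[le_nk lt_kd]]; last first.
  apply: nth_default; apply: leq_trans (size_prod_linear _ _ _) _.
  by move: le_nk; rewrite /n; lia.
have n_d : (1 < n <= d)%N by rewrite /n; lia.
apply: (eq_computes (f := fun a => vec n (l a * r a))) => [a|].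
  by rewrite def_lr.
apply: computesW.
  apply: (computes_vec_mul fastmul n_d).
    apply: (@computes_vec_take _ _ _ _ _ _ d); first by lia.
    by apply: cl => i i_m; apply: cx; lia.
  apply: (@computes_vec_take _ _ _ _ _ _ d); first by lia.
  apply: cr => [|i i_m]; first by rewrite /m1; move: le_m; rewrite expnS; lia.
  by apply: cx; lia.
have le_nd : (n <= 2 * m)%N by rewrite /n; lia.
have : (n * log2 n <= 2 * m * log2 d)%N.
  by apply: leq_mul => //; apply: leq_trunc_log; lia.
move: (log2 n) (log2 d) => ln ld le_n.
have {}le_n : (c * (n * ln) <= c * (2 * m * ld))%N by rewrite leq_mul2l le_n orbT.
have def_m : (m = m1 + (m - m1))%N by lia.
by rewrite [in X in (_ <= X)%N]def_m; lia.
Qed.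

(** More than [d] factors are treated in blocks of [d], so that the depth depends on [log2 d] and
    not on [log2 m]. Joining a block takes one product of length [d], which raises [6c + 3] to
    [7c + 3]. *)
Lemma computes_prod enc (x : A -> nat -> F) m i0 :
  (forall i, (i0 <= i < i0 + m)%N -> computes enc (fun a => [:: x a i]) 0) ->
  computes enc (fun a => vec d (\prod_(i0 <= i < i0 + m) (1 - x a i *: 'X)))
    ((7 * c + 3) * (m * log2 d ^ 2)).
Proof.
have log_d := log2_gt0 d_gt1; have d0 := ltnW d_gt1.
(* With [j = log2 d + 1], [2 ^ j] exceeds [d] and [j.+1] is at most [3 * log2 d], so [2c + 1]
   becomes [6c + 3]. *)
have base n i : (n <= d)%N ->
    (forall j, (i <= j < i + n)%N -> computes enc (fun a => [:: x a j]) 0) ->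
  computes enc (fun a => vec d (\prod_(i <= j < i + n) (1 - x a j *: 'X)))
    ((6 * c + 3) * (n * log2 d ^ 2)).
  move=> le_nd cx; apply: computesW (computes_prod_level (j := (log2 d).+1) _ cx) _.
    by rewrite (leq_trans le_nd) // ltnW // trunc_log_ltn.
  have -> : (6 * c + 3 = (2 * c + 1) * 3)%N by lia.
  rewrite -[X in (_ <= X)%N]mulnA leq_mul2l -mulnn; apply/orP; right.
  have : (n * log2 d * (log2 d).+2 <= n * log2 d * (3 * log2 d))%N.
    by rewrite leq_mul2l; apply/orP; right; lia.
  by lia.
elim/ltn_ind: m i0 => m IHm i0 cx.
have [le_md|lt_dm] := leqP m d.
  by apply: computesW (base _ _ le_md cx) _; apply: leq_mul; lia.
pose l a := \prod_(i0 <= i < i0 + d) (1 - x a i *: 'X).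
pose r a := \prod_(i0 + d <= i < i0 + d + (m - d)) (1 - x a i *: 'X).
apply: (eq_computes (f := fun a => vec d (l a * r a))) => [a|].
  by rewrite /l /r -addnA subnKC ?(ltnW lt_dm) //
     -big_cat_nat ?leq_addr // leq_add2l ltnW.
have d_d : (1 < d <= d)%N by rewrite d_gt1 /=.
apply: computesW.
  apply: (computes_vec_mul fastmul d_d).
    by apply: base => // j j_d; apply: cx; lia.
  apply: IHm; first by lia.
  by move=> j j_d; apply: cx; lia.
have le_c : (c * (d * log2 d) <= c * (d * log2 d ^ 2))%N.
  by rewrite !leq_mul2l -{1}[log2 d]expn1 leq_pexp2l // !orbT.
have def_m : (m = d + (m - d))%N by lia.
by rewrite [in X in (_ <= X)%N]def_m; move: (log2 d ^ 2)%N (log2 d) le_c => *; lia.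
Qed.

(** With [D] the product of the linear factors, the result is [X D' / D]. Its cost [7c + 7] consists
    of [6c + 6] for the inverse, 1 for [X D'] and [c] for the product. *)
Lemma computes_powersums enc (s : A -> seq F) m :
  (forall a, size (s a) = m) ->
  (forall i, (i < m)%N -> computes enc (fun a => [:: (s a)`_i]) 0) ->
  computes enc (fun=> mkseq (fun i => i%:R) d) 0 ->
  computes enc (fun a => vec d (- powersums d (s a)))
    ((7 * c + 7) * (d * log2 d) + (7 * c + 3) * (m * log2 d ^ 2)).
Proof.
move=> szs cs cnat; rewrite addnC.
have cost_d := leq_nlog d_gt1.
have d_d : (1 < d <= d)%N by rewrite d_gt1 /=.
apply: (@computes_let _ _ _ _ (fun a => vec d (linprod (s a)))).
  apply: (eq_computes (f := fun a =>
      vec d (\prod_(0 <= i < 0 + m) (1 - (s a)`_i *: 'X)))) => [a|].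
    by rewrite /linprod [in RHS](big_nth 0) szs.
  exact: computes_prod.
move=> enc1 enc1P cD; pose D a := linprod (s a).
have invD a : 'X^d %| D a * invp d (D a) - 1.
  by apply: mul_invp; rewrite linprod0 oner_neq0.
apply: (@computesW _ _ _ _ _ (3 * (2 * c + 2) * (d * log2 d) + (d + c * (d * log2 d)))%N);
  last by lia.
apply: (@computes_let _ _ _ _ (fun a => vec d (invp d (D a)))).
  apply: (computes_inverse fastmul) cD => // [|a]; last exact: linprod0.
  by rewrite ltnW /=.
move=> enc2 enc2P cI.
apply: (@computes_let _ _ _ _ (fun a => vec d ('X * (D a)^`()))).
  by apply: computes_theta; [apply: enc2P | apply/enc2P/enc1P].
move=> enc3 enc3P cT.
apply: computes_vec_eq (computes_vec_mul_avail fastmul d_d cT (enc3P _ _ cI)) => a.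
set t := - powersums d _.
have -> : 'X * (D a)^`() * invp d (D a) - t
    = ('X * (D a)^`() - t * D a) * invp d (D a) + (D a * invp d (D a) - 1) * t by ring.
by apply: dvdp_add; apply: dvdp_mulr => //; apply: logder_linprod.
Qed.

(** The program never computes [x a], which acts only by cancelling degree 1 of the logarithmic
    derivative. In [44c], the series f accounts for [6c], the two power sum series for [7c] each and
    the differential equation for [24c]; linear passes are absorbed by [60]. *)
Lemma computes_todd enc (s s' : A -> seq F) (x : A -> F) m m' :
  (forall a, size (s a) = m) -> (forall a, size (s' a) = m') ->
  (forall i, (i < m)%N -> computes enc (fun a => [:: (s a)`_i]) 0) ->
  (forall i, (i < m')%N -> computes enc (fun a => [:: (s' a)`_i]) 0) ->
  (forall a, x a = (\sum_(y <- s a) y - \sum_(y <- s' a) y) / 2%:R) ->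
  computes enc (fun a => vec d (todd_class d (x a) (s a) (s' a)))
    ((44 * c + 60) * (d * log2 d + log2 d ^ 2 * (m + m'))).
Proof.
move=> szs szs' cs cs' def_x; have cost_d := leq_nlog d_gt1; have d0 := ltnW d_gt1.
apply: (@computesW _ _ _ _ _ (d.+1 * 1 + (d.+1 * 1 + (d * 1 +
  (3 * (2 * c + 2) * (d * log2 d) +
  (((7 * c + 7) * (d * log2 d) + (7 * c + 3) * (m * log2 d ^ 2)) +
  (((7 * c + 7) * (d * log2 d) + (7 * c + 3) * (m' * log2 d ^ 2)) +
  (d + (d * 1 + 3 * (8 * c + 10) * (d * log2 d)))))))))%N); last first.
  by move: (log2 d ^ 2)%N => *; nia.
(* The integers are built by adding 1, as they need not be loadable constants. The table goes up to
   [d] itself because the last coefficient of [expm1_poly F d] is [1 / d!]. *)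
apply: (@computes_let _ _ _ _ (fun=> mkseq (fun i => i%:R) d.+1)).
  apply: computes_rec => -[|i] enc' enc'P lt_i cu.
    by apply: computesW (computes0 _ _) _.
  apply: (eq_computes (f := fun=> [:: i%:R + 1])) => [a|]; first by rewrite natr1.
  apply: (computes_add (x := fun=> i%:R) (y := fun=> 1)); last exact: computes1.
  exact: (computes_nth (u := fun _ i => i%:R) cu).
move=> enc1 enc1P cnat'.
apply: (@computes_let _ _ _ _ (fun=> mkseq (fun i => (i%:R)^-1) d.+1)).
  apply: computes_mkseq => -[|i] lt_i.
    (* Inverting 0 is not admissible, so the entry [0^-1 = 0] is loaded as a constant. *)
    apply: (eq_computes (f := fun=> [:: 0])) => [a|]; first by rewrite invr0.
    by apply: computesW (computes0 _ _) _.
  apply: (computes_inv (x := fun=> i.+1%:R)) => [a|]; first by rewrite unitk.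
  exact: (computes_nth (u := fun _ i => i%:R) cnat').
move=> enc2 enc2P cinv'.
apply: (@computes_let _ _ _ _ (fun=> vec d (expm1_poly F d))).
  apply: computes_rec => -[|i] enc' enc'P lt_i cu.
    apply: (eq_computes (f := fun=> [:: 1])) => [a|]; first by rewrite expm1_poly0.
    by apply: computesW (computes1 _ _) _.
  apply: (eq_computes (f := fun=> [:: (expm1_poly F d)`_i * i.+2%:R^-1])) => [a|].
    by rewrite !coef_poly lt_i (ltnW lt_i) [(i.+2)`!]factS natrM invfM mulrC.
  apply: (computes_mul (x := fun=> _) (y := fun=> _)).
    exact: (computes_nth (u := fun _ i => (expm1_poly F d)`_i) cu).
  by apply: (computes_nth (u := fun _ i => i%:R^-1) (enc'P _ _ cinv')).
move=> enc3 enc3P cE.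
have cnat : computes enc3 (fun=> mkseq (fun i => i%:R) d) 0.
  rewrite -(muln0 d); apply: computes_mkseq => i lt_i; apply/enc3P/enc2P.
  exact: (computes_nth (u := fun _ i => i%:R) cnat' (ltnW lt_i)).
have cinv : computes enc3 (fun=> mkseq (fun i => i%:R^-1) d) 0.
  rewrite -(muln0 d); apply: computes_mkseq => i lt_i; apply/enc3P.
  exact: (computes_nth (u := fun _ i => i%:R^-1) cinv' (ltnW lt_i)).
apply: (@computes_let _ _ _ _ (fun=> vec d (todd_poly F d))).
  apply: (computes_inverse fastmul) cE => [|a|a]; first by rewrite d0 /=.
    exact: expm1_poly0.
  exact: todd_polyP.
move=> enc4 enc4P cf.
apply: (@computes_let _ _ _ _ (fun a => vec d (- powersums d (s a)))).
  apply: computes_powersums => // [i lt_i|]; last exact: enc4P.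
  exact/enc4P/enc3P/enc2P/enc1P/cs.
move=> enc5 enc5P cp.
apply: (@computes_let _ _ _ _ (fun a => vec d (- powersums d (s' a)))).
  apply: computes_powersums => // [i lt_i|]; last exact/enc5P/enc4P.
  exact/enc5P/enc4P/enc3P/enc2P/enc1P/cs'.
move=> enc6 enc6P cp'.
(* The difference of the negated series has the coefficients [p_k(s') - p_k(s)] of H, up to the
   factors [f_k]. *)
apply: (@computes_let _ _ _ _
  (fun a => vec d (- powersums d (s a) - - powersums d (s' a)))).
  by apply: computes_vec_sub => //; apply: enc6P.
move=> enc7 enc7P cpp.
apply: (@computes_let _ _ _ _ (fun a => vec d (todd_logder d (s a) (s' a)))).
  apply: computes_mkseq => i lt_i; have [i2|i2] := ltnP i 2.
    apply: (eq_computes (f := fun=> [:: 0])) => [a|]; first by rewrite coef_poly lt_i i2.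
    by apply: computesW (computes0 _ _) _.
  apply: (eq_computes (f := fun a => [:: (todd_poly F d)`_i *
      (- powersums d (s a) - - powersums d (s' a))`_i])) => [a|].
    by rewrite [in RHS]coef_poly lt_i ltnNge i2 opprK addrC.
  apply: computes_mul; last exact: computes_vec_coef cpp _.
  apply: (computes_vec_coef (p := fun=> todd_poly F d)) lt_i.
  exact/enc7P/enc6P/enc5P.
move=> enc8 enc8P ch.
apply: (computes_exp fastmul) ch _ _ => [|k|a|a||].
- by rewrite d0 /=.
- by move=> /andP[k0 lt_k]; apply: unitk; rewrite k0 (ltnW lt_k).
- exact: todd_class0.
- exact: logder_todd_class.
- exact/enc8P/enc7P/enc6P/enc5P/enc4P.
- exact/enc8P/enc7P/enc6P/enc5P/enc4P.
Qed.

End ToddAlgorithm.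

(** * Reduction modulo p *)

Section Reduction.

Variable F : fieldType.
Implicit Types (x y : rat) (a b : F) (u v : fps rat) (p q : {poly F}).

(* The fraction need not be in lowest terms, which makes compatibility with the
   ring operations immediate. *)
Definition reduces x a := exists n e : int,
  [/\ e%:~R != 0 :> F, x = n%:~R / e%:~R & a = n%:~R / e%:~R].

Lemma intr_unit_neq0 (e : int) : e%:~R != 0 :> F -> e%:~R != 0 :> rat.
Proof. by apply: contraNneq => /eqP; rewrite intr_eq0 => /eqP->. Qed.

Lemma reduces_int (n : int) : reduces n%:~R n%:~R.
Proof. by exists n, 1; rewrite oner_neq0 !divr1. Qed.

Lemma reduces_nat (n : nat) : reduces n%:R n%:R.
Proof. by rewrite !pmulrn; apply: reduces_int. Qed.

Lemma reducesN x a : reduces x a -> reduces (- x) (- a).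
Proof.
by case=> n [e [e0 -> ->]]; exists (- n), e; rewrite e0 !rmorphN !mulNr.
Qed.

Lemma reducesD x y a b : reduces x a -> reduces y b -> reduces (x + y) (a + b).
Proof.
case=> n [e [e0 -> ->]] [n' [e' [e0' -> ->]]].
exists (n * e' + n' * e), (e * e').
by rewrite !rmorphM mulf_neq0 // !rmorphD !rmorphM !addf_div ?intr_unit_neq0.
Qed.

Lemma reducesM x y a b : reduces x a -> reduces y b -> reduces (x * y) (a * b).
Proof.
case=> n [e [e0 -> ->]] [n' [e' [e0' -> ->]]].
by exists (n * n'), (e * e'); rewrite !rmorphM mulf_neq0 // !mulf_div.
Qed.

Lemma reducesV x a : a != 0 -> reduces x a -> reduces x^-1 a^-1.
Proof.
move=> a0 [n [e [e0 -> def_a]]]; exists e, n.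
split; [apply: contra_neq a0 => n0 | by rewrite invf_div | by rewrite def_a invf_div].
by rewrite def_a n0 mul0r.
Qed.

Lemma reducesX x a k : reduces x a -> reduces (x ^+ k) (a ^+ k).
Proof.
move=> xa; elim: k => [|k IHk]; first exact: (reduces_nat 1).
by rewrite !exprS; apply: reducesM.
Qed.

Lemma reduces_sum n (f : 'I_n -> rat) (g : 'I_n -> F) :
  (forall i, reduces (f i) (g i)) -> reduces (\sum_i f i) (\sum_i g i).
Proof.
move=> fg; elim: n f g fg => [|n IHn] f g fg.
  by rewrite !big_ord0; apply: (reduces_nat 0).
by rewrite !big_ord_recl; apply: reducesD => //; apply: IHn => i.
Qed.

Definition reduces_fps n u p := forall k, (k < n)%N -> reduces (u k) p`_k.

Lemma reduces_fps_mul n u v p q :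
  reduces_fps n u p -> reduces_fps n v q -> reduces_fps n (fps_mul u v) (p * q).
Proof.
move=> up vq k lt_k; rewrite coefM; apply: reduces_sum => i.
apply: reducesM; first by apply: up; apply: leq_ltn_trans lt_k; rewrite -ltnS.
by apply: vq; apply: leq_ltn_trans (leq_subr _ _) lt_k.
Qed.

Lemma reduces_fps_prod n (I : Type) (s : seq I) (f : I -> fps rat)
    (g : I -> {poly F}) : (forall i, reduces_fps n (f i) (g i)) ->
  reduces_fps n (\big[fps_mul/fps_one]_(i <- s) f i) (\prod_(i <- s) g i).
Proof.
move=> fg; elim: s => [|i s IHs]; last by rewrite !big_cons; apply: reduces_fps_mul.
by rewrite !big_nil => k _; rewrite coef1; apply: reduces_nat.
Qed.

(** With constant term 1, both inverses obey the same division-free recursion on coefficients. *)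
Lemma reduces_fps_inv n u p q : u 0%N = 1 -> p`_0 = 1 ->
  reduces_fps n u p -> 'X^n %| p * q - 1 -> reduces_fps n (fps_inv u) q.
Proof.
move=> u0 p0 up inv_pq; elim/ltn_ind=> -[|k] IHk lt_k.
  rewrite (inverse_coef0 lt_k p0 inv_pq) /fps_inv /= u0 invr1.
  exact: (reduces_nat 1).
have q_k : q`_k.+1 = - \sum_(i < k.+1) p`_i.+1 * q`_(k - i).
  have := dvdXn_sub_coef inv_pq lt_k.
  rewrite coef1 coefM big_ord_recl p0 mul1r subn0 => /eqP.
  by rewrite addr_eq0 => /eqP.
have v_k : fps_inv u k.+1 = - \sum_(i < k.+1) u i.+1 * fps_inv u (k - i)%N.
  have /eqP : fps_mul u (fps_inv u) k.+1 = 0 by rewrite fps_mulV ?u0.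
  by rewrite /fps_mul big_ord_recl u0 mul1r subn0 addr_eq0 => /eqP.
rewrite q_k v_k; apply: reducesN; apply: reduces_sum => i.
apply: reducesM; first by apply: up; apply: leq_ltn_trans lt_k; rewrite ltnS -ltnS.
have le_ki : (k - i < k.+1)%N by rewrite ltnS leq_subr.
by apply: IHk => //; apply: ltn_trans le_ki lt_k.
Qed.

Lemma reduces_fps_scale n u p (b : int) :
  reduces_fps n u p -> reduces_fps n (fps_scale b%:~R u) (p \Po (b%:~R *: 'X)).
Proof.
move=> up k lt_k; rewrite coef_comp_scale; apply: reducesM; last exact: up.
exact/reducesX/reduces_int.
Qed.

Lemma fact_neq0 n k : (forall i, (0 < i <= n)%N -> i%:R != 0 :> F) ->
  (k <= n)%N -> k`!%:R != 0 :> F.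
Proof.
move=> unitk; elim: k => [|k IHk] le_k; first by rewrite oner_neq0.
by rewrite factS natrM; apply: mulf_neq0; [apply: unitk | apply/IHk/ltnW].
Qed.

Lemma reduces_todd_f n : (forall k, (0 < k <= n)%N -> k%:R != 0 :> F) ->
  reduces_fps n todd_f (todd_poly F n).
Proof.
case: n => // n unitk.
apply: reduces_fps_inv (todd_polyP F _) => //; first exact: expm1_poly0.
move=> k lt_k; rewrite coef_poly lt_k /fps_exp expr1n mul1r.
by apply: reducesV; [apply: fact_neq0 lt_k | apply: reduces_nat].
Qed.

(** Reduction of [x] is only required for [1 < n]: the constant term does not involve it, and for
    [p = 2], where [d] is at most 1, the half-integer [x] may fail to reduce. *)
Lemma reduces_td n x a (B B' : seq int) :
  (forall k, (0 < k <= n)%N -> k%:R != 0 :> F) ->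
  ((1 < n)%N -> reduces x a) ->
  reduces_fps n (td x B B')
    (todd_class n a [seq b%:~R | b : int <- B] [seq b%:~R | b : int <- B']).
Proof.
move=> unitk xa; have [-> //|n0] := posnP n.
have todd_b (b : int) := reduces_fps_scale b (reduces_todd_f unitk).
have todd0 (b : int) : (todd_poly F n \Po (b%:~R *: 'X))`_0 = 1.
  by rewrite coef_comp_scale mul1r todd_poly0.
rewrite /todd_class !big_map; apply: reduces_fps_mul => [k lt_k|].
  rewrite coef_poly lt_k; apply: reducesM.
    case: k lt_k => [|k] lt_k; first by rewrite !expr0; apply: (reduces_nat 1).
    by apply/reducesX/xa; apply: leq_ltn_trans lt_k.
  by apply: reducesV; [apply: fact_neq0 (ltnW lt_k) | apply: reduces_nat].
apply: reduces_fps_mul; first exact: reduces_fps_prod.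
apply: reduces_fps_prod => b; apply: reduces_fps_inv (todd_b b) _ => //.
by apply: mul_invp; rewrite todd0 oner_neq0.
Qed.

End Reduction.

Lemma intr_Fp_eq0 (p : nat) (n : int) :
  prime p -> (n%:~R == 0 :> 'F_p) = (p %| `|n|)%N.
Proof.
move=> p_pr; have charp := pchar_Fp p_pr; rewrite (dvdn_pcharf charp).
by case: n => n //; rewrite NegzE rmorphN oppr_eq0.
Qed.

(** Cross-multiplying with the reduced fraction shows that [denq x] divides [numq x * e], hence [e],
    which is prime to [p]. *)
Lemma reduces_ratr (p : nat) (x : rat) (a : 'F_p) : prime p ->
  reduces x a -> ~~ (p %| `|denq x|)%N /\ a = ratr x.
Proof.
move=> p_pr [n [e [e0 def_x ->]]]; have e0Q := intr_unit_neq0 e0.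
have cross : n * denq x = numq x * e.
  apply: (@intr_inj rat); rewrite !rmorphM /=; apply/eqP.
  by rewrite -eqr_div ?intr_eq0 ?denq_neq0 // -?(intr_eq0 rat) // divq_num_den def_x.
have den_p : ~~ (p %| `|denq x|)%N.
  apply: contra e0; rewrite intr_Fp_eq0 // => /dvdn_trans; apply.
  rewrite -(@Gauss_dvdr _ `|numq x|) -1?abszM -1?cross ?abszM ?dvdn_mull //.
  by rewrite coprime_sym coprime_num_den.
split=> //; rewrite /ratr; apply/eqP.
by rewrite eqr_div ?intr_Fp_eq0 // -?(intr_Fp_eq0 _ p_pr) // -!rmorphM cross.
Qed.

Theorem theorem23 (c : nat) :
  exists C : nat,
  forall (p d : nat) (K : {pred 'F_p}),
    prime p -> (d < p)%N -> fast_multiplication K c d ->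
  forall m m' : nat,
  exists P : slp 'F_p,
    (slp_cost P <= C * (d * log2 d + log2 d ^ 2 * (m + m')))%N /\
    forall (B0 B0' : seq int) (a : rat),
      size B0 = m -> size B0' = m' ->
      0 \notin B0 -> 0 \notin B0' ->
      a = (p1 B0 - p1 B0')%:~R / 2%:R ->
      exists2 x : seq 'F_p,
        slp_eval K P [seq b%:~R | b <- B0 ++ B0'] = Some x &
        reduction_mod (mkseq (td a B0 B0') d) x.
Proof.
exists (44 * c + 60)%N => p d K p_pr lt_dp fastmul m m'.
have unitk k : (0 < k <= d)%N -> k%:R != 0 :> 'F_p.
  case/andP=> k0 le_kd; rewrite pmulrn intr_Fp_eq0 //.
  by rewrite gtnNdvd // (leq_ltn_trans le_kd).
(* Indexing inputs by tuples of fixed lengths yields one program for all multisets of these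
   sizes. *)
pose A := (m.-tuple int * m'.-tuple int)%type.
pose enc (B : A) : seq 'F_p := [seq b%:~R | b <- B.1 ++ B.2].
pose s (B : A) : seq 'F_p := [seq b%:~R | b <- B.1].
pose s' (B : A) : seq 'F_p := [seq b%:~R | b <- B.2].
pose x B := (\sum_(y <- s B) y - \sum_(y <- s' B) y) / 2%:R.
pose f B := todd_class d (x B) (s B) (s' B).
have szs B : size (s B) = m by rewrite size_map size_tuple.
have szs' B : size (s' B) = m' by rewrite size_map size_tuple.
have : computes K enc (fun B => vec d (f B))
    ((44 * c + 60) * (d * log2 d + log2 d ^ 2 * (m + m'))).
  have [d_gt1|d_le1] := ltnP 1 d.
    apply: (computes_todd fastmul d_gt1 unitk szs szs') => // i lt_i.
      apply: eq_computes (computes_select _ enc [:: i]) => B.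
      by rewrite /= /enc map_cat nth_cat szs lt_i.
    apply: eq_computes (computes_select _ enc [:: (m + i)%N]) => B.
    by rewrite /= /enc map_cat nth_cat szs ltnNge leq_addr addKn.
  (* For [d <= 1] the bound is 0, so the program must be free: it outputs nothing, or the constant
     term 1. *)
  apply: computesW (leq0n _).
  have [-> | d0] := posnP d; first exact: (computes_select _ enc [::]).
  apply: eq_computes (computes1 _ _) => B; have -> : d = 1%N by lia.
  by rewrite /vec /mkseq /= todd_class0.
case=> /(_ (m + m')%N) [B|P [costP evP]]; first by rewrite size_map size_cat !size_tuple.
exists P; split=> // B0 B0' a /eqP sz0 /eqP sz0' _ _ def_a.
pose B : A := (Tuple sz0, Tuple sz0').
exists (vec d (f B)); first exact: (evP B).
have red_td k : (k < d)%N -> reduces (td a B0 B0' k) (f B)`_k.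
  apply: reduces_td => // d_gt1; rewrite def_a /x.
  apply: reducesM; last first.
    by apply: reducesV; [rewrite unitk | apply: reduces_nat].
  have -> : \sum_(y <- s B) y - \sum_(y <- s' B) y = (p1 B0 - p1 B0')%:~R.
    by rewrite /p1 rmorphB !rmorph_sum !big_map.
  exact: reduces_int.
split.
  apply/allP=> _ /mapP[k + ->]; rewrite mem_iota => /red_td red_k.
  by have [] := reduces_ratr p_pr red_k.
rewrite -map_comp; apply/eq_in_map => k; rewrite mem_iota => /red_td red_k.
by have [] := reduces_ratr p_pr red_k.
Qed.
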